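(* Let $q$ be a prime power and $A,\Theta\subseteq\mathbb{F}_q$. Suppose that $|A|^2|\Theta|>q^2$. Then there exists $\theta\in\Theta$ such that $|A+\theta A|>q/2$. Consequently: (i) if $|A|>q^{2/3}$, there exists $a\in A$ such that $|aA+A|>q/2$; (ii) if $|A|^2|AA^{-1}|>q^2$, there exist $a,b\in A$ such that $|aA+bA|>q/2$.
   Context: For $X,Y\subseteq\mathbb{F}_q$ and $c\in\mathbb{F}_q$: $X+Y=\{x+y:x\in X,y\in Y\}$, $cX=\{cx:x\in X\}$. $AA^{-1}=\{ab^{-1}: a,b\in A,\ b\neq 0\}$. *)

(* Defs.v *)
From HB Require Import structures.
From mathcomp Require Import all_boot all_order all_algebra.

Set Implicit Arguments.
Unset Strict Implicit.
Unset Printing Implicit Defensive.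

Import GRing.Theory.
Local Open Scope ring_scope.

Definition sumset (F : finFieldType) (X Y : {set F}) : {set F} :=
  [set x + y | x in X, y in Y].

Definition dilate (F : finFieldType) (c : F) (X : {set F}) : {set F} :=
  [set c * x | x in X].

(* The set A A^{-1}; the zero denominator is excluded explicitly because
   0^-1 = 0 in MathComp. *)
Definition ratioset (F : finFieldType) (A : {set F}) : {set F} :=
  [set a * b^-1 | a in A, b in A & b != 0].

(* Main.v *)
(** Write m = |A|^2 and let E(t) be the number of pairs of points of A x A
   with the same image under (x, y) |-> x + t y.  By Cauchy-Schwarz
   m^2 <= |A + t A| E(t), and in particular m^2 <= q E(t) for every t.
   Two distinct points collide for at most one t, so the sum of E(t) over the
   whole field is at most q m + m^2.  If |A + t A| <= q/2 on Theta, then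
   q E(t) >= 2 m^2 there and q E(t) >= m^2 elsewhere; summing over the field
   gives |Theta| m <= q^2. *)
Require Import Defs.
From HB Require Import structures.
From mathcomp Require Import all_boot all_order all_algebra.
From mathcomp Require Import reals exp.

Set Implicit Arguments.
Unset Strict Implicit.
Unset Printing Implicit Defensive.

Import Order.TTheory GRing.Theory Num.Theory.
Local Open Scope ring_scope.

(** Cauchy-Schwarz against the constant 1: after doubling, expand the square over pairs (i, j) and
    sum 2 n_i n_j <= n_i^2 + n_j^2. *)
Lemma leq_sqr_sum (I : finType) (P : {set I}) (n : I -> nat) :
  ((\sum_(i in P) n i) ^ 2 <= #|P| * \sum_(i in P) n i ^ 2)%N.
Proof.
rewrite -(leq_pmul2l (ltn0Sn 1)) -mulnn big_distrlr /= big_distrr /=.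
have -> : (2 * (#|P| * \sum_(i in P) n i ^ 2) =
    \sum_(i in P) \sum_(j in P) (n i ^ 2 + n j ^ 2))%N.
  under [RHS]eq_bigr => i _ do rewrite big_split /= sum_nat_const.
  by rewrite big_split /= sum_nat_const -big_distrr /= addnn mul2n.
apply: leq_sum => i _; rewrite big_distrr /=; apply: leq_sum => j _.
exact: nat_Cauchy.
Qed.

(** Pairs are ordered and the diagonal counts. With [slope_proj t] on A x A this is E(t). *)
Definition collisions (T S : finType) (f : T -> S) (P : {set T}) : nat :=
  \sum_(x in P) \sum_(y in P) (f x == f y).

Lemma collisionsE (T S : finType) (f : T -> S) (P : {set T}) :
  collisions f P = (\sum_(s in f @: P) #|[set x in P | f x == s]| ^ 2)%N.
Proof.
rewrite /collisions (partition_big_imset f) /=.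
apply: eq_bigr => s _.
rewrite -mulnn -sum_nat_const.
rewrite [RHS](eq_bigl (fun x => (x \in P) && (f x == s))); last first.
  by move=> x; rewrite inE.
apply: eq_bigr => x /andP[_ /eqP ->].
rewrite -sum1_card [RHS]big_mkcond [LHS]big_mkcond /=; apply: eq_bigr => y _.
by rewrite inE eq_sym; case: (y \in P); case: (_ == _).
Qed.

(** The fibres of [f] partition [P], and [collisions] is the sum of their squared sizes, so
    Cauchy-Schwarz over the image applies. *)
Lemma leq_sqr_card_collisions (T S : finType) (f : T -> S) (P : {set T}) :
  (#|P| ^ 2 <= #|f @: P| * collisions f P)%N.
Proof.
suff -> : #|P| = (\sum_(s in f @: P) #|[set x in P | f x == s]|)%N.
  by rewrite collisionsE leq_sqr_sum.
rewrite -sum1_card (partition_big_imset f) /=; apply: eq_bigr => s _.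
by rewrite -sum1_card; apply: eq_bigl => x; rewrite inE.
Qed.

Definition slope_proj (F : finFieldType) (t : F) (p : F * F) : F :=
  p.1 + t * p.2.

(** Both t and u solve v (x2 - y2) = y1 - x1. Here x2 != y2, since otherwise x1 = y1 as well and the
    points coincide. *)
Lemma slope_proj_inj (F : finFieldType) (x y : F * F) (t u : F) : x != y ->
  slope_proj t x = slope_proj t y -> slope_proj u x = slope_proj u y -> t = u.
Proof.
case: x y => [x1 x2] [y1 y2]; rewrite /slope_proj /= => x_neq_y et eu.
have [e2|ne2] := eqVneq x2 y2.
  by move: et x_neq_y; rewrite e2 => /addIr ->; rewrite eqxx.
have slope v : x1 + v * x2 = y1 + v * y2 -> v * (x2 - y2) = y1 - x1.
  by move=> ev; rewrite mulrBr -[v * x2](addKr x1) ev addrA addrK addrC.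
by apply: (mulIf (x := x2 - y2)); rewrite ?subr_eq0 // (slope t) ?(slope u).
Qed.

Lemma sum_collisions_proj (F : finFieldType) (P : {set F * F}) :
  (\sum_(t : F) collisions (slope_proj t) P <= #|F| * #|P| + #|P| ^ 2)%N.
Proof.
rewrite exchange_big /= -mulnn mulnC -mulnDr -sum_nat_const.
apply: leq_sum => x Px.
(* For fixed x, the diagonal y = x collides for all |F| slopes, and each other y for at most one. *)
rewrite exchange_big /= (bigD1 x) //=; apply: leq_add.
  by rewrite (eq_bigr (fun=> 1%N)) ?sum1_card // => t _; rewrite eqxx.
apply: (@leq_trans (\sum_(y in P | y != x) 1)); last first.
  by rewrite -sum1_card [leqRHS](bigD1 x) //= leq_addl.
apply: leq_sum => y /andP[_ y_neq_x].
rewrite -big_mkcond /= sum1_card; apply/card_le1_eqP => t u.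
rewrite !unfold_in /= => /eqP et /eqP eu.
by apply: slope_proj_inj eu et; rewrite eq_sym.
Qed.

Lemma exists_large_proj (F : finFieldType) (P : {set F * F})
    (Theta : {set F}) :
  (#|F| ^ 2 < #|P| * #|Theta|)%N ->
  exists2 t, t \in Theta & (#|F| < 2 * #|slope_proj t @: P|)%N.
Proof.
move=> large; apply/exists_inP; apply: contraLR large.
rewrite negb_exists_in -leqNgt => /forall_inP small.
(* A factor |P| is cancelled at the very end, so it must be positive. *)
have [->|P_gt0] := posnP #|P|; first by rewrite mul0n.
have lower t : (#|P| ^ 2 + (t \in Theta) * #|P| ^ 2
    <= #|F| * collisions (slope_proj t) P)%N.
  have cs := leq_sqr_card_collisions (slope_proj t) P.
  case: (boolP (t \in Theta)) => [/small|_].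
    rewrite -leqNgt mul1n addnn -mul2n => le_q.
    apply: leq_trans (leq_mul le_q (leqnn _)).
    by rewrite -mulnA leq_mul2l cs orbT.
  by rewrite mul0n addn0 (leq_trans cs) // leq_mul2r max_card orbT.
have := leq_sum (index_enum F) (fun t (_ : true) => lower t).
rewrite big_split /= sum_nat_const -big_distrl -big_distrr /=.
rewrite -big_mkcond sum1_card => /leq_trans bound.
have {}bound := bound _ (leq_mul (leqnn _) (sum_collisions_proj P)).
(* With m = |P|, the term q m^2 occurs on both sides; removing it leaves |Theta| m^2 <= q^2 m. *)
move: bound; rewrite mulnDr addnC leq_add2r mulnA mulnn.
by rewrite -[(#|P| ^ 2)%N]mulnn mulnA leq_pmul2r // mulnC.
Qed.

Lemma sumset_dilateE (F : finFieldType) (t : F) (A : {set F}) :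
  sumset A (dilate t A) = slope_proj t @: setX A A.
Proof.
apply/setP=> z; apply/imset2P/imsetP => [[x _ xA /imsetP[y yA ->] ->]|].
  by exists (x, y); rewrite ?inE ?xA.
case=> -[x y]; rewrite inE => /andP[/= xA yA] ->.
by exists x (t * y) => //; apply: imset_f.
Qed.

Lemma sumsetC (F : finFieldType) (X Y : {set F}) : sumset X Y = sumset Y X.
Proof.
by apply/setP=> z; apply/imset2P/imset2P=> -[x y xX yY ->]; exists y x => //;
   rewrite addrC.
Qed.

Lemma dilate_sumset (F : finFieldType) (c : F) (X Y : {set F}) :
  dilate c (sumset X Y) = sumset (dilate c X) (dilate c Y).
Proof.
apply/setP=> z; apply/imsetP/imset2P.
  move=> [_ /imset2P[x y xX yY ->] ->].
  by exists (c * x) (c * y); rewrite ?imset_f ?mulrDr.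
move=> [_ _ /imsetP[x xX ->] /imsetP[y yY ->] ->].
by exists (x + y); rewrite ?imset2_f ?mulrDr.
Qed.

Lemma dilateM (F : finFieldType) (c d : F) (X : {set F}) :
  dilate c (dilate d X) = dilate (c * d) X.
Proof.
by rewrite /dilate -imset_comp; apply: eq_imset => x /=; rewrite mulrA.
Qed.

Lemma card_dilate (F : finFieldType) (c : F) (X : {set F}) :
  c != 0 -> #|dilate c X| = #|X|.
Proof. by move=> c0; apply: card_imset; apply: mulfI. Qed.

Lemma exists_large_sumset (F : finFieldType) (A Theta : {set F}) :
  (#|F| ^ 2 < #|A| ^ 2 * #|Theta|)%N ->
  exists2 t, t \in Theta & (#|F| < 2 * #|sumset A (dilate t A)|)%N.
Proof.
rewrite -mulnn -[in X in (_ < X)%N]mulnn -cardsX => /exists_large_proj[t tT lt_q].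
by exists t; rewrite ?sumset_dilateE.
Qed.

Lemma ltr_half_nat (R : realType) (q n : nat) :
  (q%:R / 2 < n%:R :> R) = (q < 2 * n)%N.
Proof. by rewrite ltr_pdivrMr // -natrM ltr_nat mulnC. Qed.

Theorem theorem6 (R : realType) (F : finFieldType) (q : nat) (hq : #|F| = q)
    (A : {set F}) :
  [/\ forall Theta : {set F},
        (#|A| ^ 2 * #|Theta| > q ^ 2)%N ->
        exists2 theta : F, theta \in Theta &
          #|sumset A (dilate theta A)|%:R > q%:R / 2 :> R,
      #|A|%:R > q%:R `^ (2 / 3) :> R ->
        exists2 a : F, a \in A &
          #|sumset (dilate a A) A|%:R > q%:R / 2 :> R
    & (#|A| ^ 2 * #|ratioset A| > q ^ 2)%N ->
        exists a b : F, [/\ a \in A, b \in A &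
          #|sumset (dilate a A) (dilate b A)|%:R > q%:R / 2 :> R] ].
Proof.
rewrite -hq; split.
- move=> Theta /exists_large_sumset[t tT lt_q].
  by exists t; rewrite ?ltr_half_nat.
- move=> largeA.
  have /exists_large_sumset[a aA lt_q] : (#|F| ^ 2 < #|A| ^ 2 * #|A|)%N.
    rewrite -expnSr -(ltr_nat R) !natrX.
    (* Take Theta = A: cubing the hypothesis on |A| gives |A|^3 > q^2. *)
    have -> : #|F|%:R ^+ 2 = (#|F|%:R `^ (2 / 3)) ^+ 3 :> R.
      by rewrite -!powR_mulrn ?powR_ge0 // -powRrM divfK ?pnatr_eq0.
    by rewrite ltrXn2r ?powR_ge0.
  by exists a; rewrite // ltr_half_nat sumsetC.
- move=> /exists_large_sumset[_ /imset2P[a b aA + ->] lt_q].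
  rewrite inE => /andP[bA b0].
  exists a, b; split=> //; rewrite ltr_half_nat.
  (* Dilation by b != 0 preserves size and turns A + (a/b) A into bA + aA. *)
  rewrite -(card_dilate _ b0) dilate_sumset dilateM in lt_q.
  by rewrite mulrCA divff // mulr1 sumsetC in lt_q.
Qed.
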